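(* Let $\mathbf{C}$ be a translating-rotating soliton ($\alpha=0$, $\mathbf{v}\neq0$, $\mathcal{A}\mathbf{v}=0$). Then $z(s)=\langle\mathbf{v},\mathbf{C}(s)\rangle$ has at most one minimum, and at each end the limit of $z$ exists and is infinite: each of $\lim_{s\to\infty}z(s)$ and $\lim_{s\to-\infty}z(s)$ equals either $+\infty$ or $-\infty$. Furthermore, the $R(\mathcal{A})$ component $\mathbf{W}(s)$ of $\mathbf{C}(s)$ satisfies: each of the limits $\lim_{s\to\infty}\|\mathbf{W}(s)\|$ and $\lim_{s\to-\infty}\|\mathbf{W}(s)\|$ exists and equals either $0$ or $\infty$.
   Context: Let $\mathcal{A}$ be a real antisymmetric $n\times n$ matrix and $\mathbf{v}\in\mathbb{R}^n$ with $\mathcal{A}\mathbf{v}=0$. A translating-rotating soliton is a smooth curve $\mathbf{C}:\mathbb{R}\to\mathbb{R}^n$, parametrized by arc length $s$, satisfying $\mathbf{C}_{ss}=\mathcal{A}\mathbf{C}+\mathbf{v}+\lambda\mathbf{C}_s$, where $\lambda(s)=-\langle\mathcal{A}\mathbf{C}+\mathbf{v},\mathbf{C}_s\rangle$ is determined by $\mathbf{C}_s\perp\mathbf{C}_{ss}$. $\mathbf{W}(s)$ is the orthogonal projection of $\mathbf{C}(s)$ onto the range $R(\mathcal{A})=N(\mathcal{A})^\perp$. *)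

(* Defs.v *)
From mathcomp Require Import all_boot all_order all_algebra.
From mathcomp Require Import all_classical all_reals all_analysis.

Set Implicit Arguments.
Unset Strict Implicit.
Unset Printing Implicit Defensive.

Import Order.TTheory GRing.Theory Num.Theory.
Import numFieldNormedType.Exports.

Local Open Scope classical_set_scope.
Local Open Scope ring_scope.

Definition inner (R : realType) (n : nat) (x y : 'cV[R]_n) : R :=
  \sum_(i < n) x i ord0 * y i ord0.

(* The library norm `|x| on matrices is the sup norm, hence this separate
   Euclidean norm; both induce the same topology, so derivatives of curves
   are unaffected. *)
Definition enorm (R : realType) (n : nat) (x : 'cV[R]_n) : R :=
  Num.sqrt (inner x x).

Definition antisymmetric_mx (R : realType) (n : nat) (A : 'M[R]_n) : Prop :=
  A^T = - A.

Definition smooth_curve (R : realType) (n : nat) (C : R -> 'cV[R]_n) : Prop :=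
  forall (k : nat) (s : R), derivable (derive1n k C) s 1.

Definition soliton_lambda (R : realType) (n : nat) (A : 'M[R]_n)
    (v : 'cV[R]_n) (C : R -> 'cV[R]_n) (s : R) : R :=
  - inner (A *m C s + v) (derive1 C s).

Record translating_rotating_soliton (R : realType) (n : nat) (A : 'M[R]_n)
    (v : 'cV[R]_n) (C : R -> 'cV[R]_n) : Prop := {
  soliton_smooth : smooth_curve C;
  soliton_arclength : forall s : R, enorm (derive1 C s) = 1;
  soliton_eq : forall s : R,
    derive1n 2 C s = A *m C s + v + soliton_lambda A v C s *: derive1 C s
}.

Definition is_ortho_proj (R : realType) (n : nat) (E : set 'cV[R]_n)
    (x p : 'cV[R]_n) : Prop :=
  E p /\ forall y : 'cV[R]_n, E y -> inner (x - p) y = 0.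

Definition mx_range (R : realType) (n : nat) (A : 'M[R]_n) : set 'cV[R]_n :=
  range (fun x : 'cV[R]_n => A *m x).

Definition is_local_min (R : realType) (f : R -> R) (a : R) : Prop :=
  \forall x \near a, f a <= f x.

(* Main.v *)
Require Import Defs.
From mathcomp Require Import all_boot all_order all_algebra.
From mathcomp Require Import all_classical all_reals all_analysis.
From mathcomp Require Import ring lra.

Set Implicit Arguments.
Unset Strict Implicit.
Unset Printing Implicit Defensive.

Import Order.TTheory GRing.Theory Num.Theory.
Import numFieldNormedType.Exports.
Local Open Scope classical_set_scope.
Local Open Scope ring_scope.


(** Everything reduces to scalar ordinary differential equations along the
    curve.  Write T = C_s, X = A C + v, m = |v|^2 > 0, and let P be the
    orthogonal projection onto the range of A, so that W = P C.  Differentiating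
    the soliton equation, and using that A is antisymmetric and A v = 0, gives
      - lam' = - |C_ss|^2, so that lam is nonincreasing;
      - z'' = lam z' + m;
      - for r = |W|^2 and r1 = <W, T>: r' = 2 r1 and r1' = lam r1 + |P T|^2.
    Moreover |z'|, |r1| / |W| are bounded, |lam| grows at most linearly, and
    |W| <= c |A W| with |A W|^2 <= 2 |C_ss|^2 + 2 lam^2 |P T|^2.

    As lam is nonincreasing, an inequality f' >= lam f propagates f > 0 forward
    ([differential_ineq_gt0]); both z' and r1 satisfy it.

    A critical point of z has z'' = m > 0, so z' > 0 from there on and no second
    critical point can follow ([z_unique_min]).

    For the limit of z at +oo: if lam stays positive, then z' > - m / (2 lam(0))
    at one instant would persist and force z'' >= m / 2 for ever, against the
    bound on z'; so z' <= - m / (2 lam(0)) throughout and z --> -oo.  If lam is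
    nonpositive at some instant, it remains so, and z' is eventually positive.
    Were z bounded, with supremum Z, then with |lam s| <= a + b s the quantity
    z' + (a + b s) z - b Z s would have derivative at least m / 2 while being
    bounded above.  Hence z --> +oo ([z_cvg_infty]).

    For |W| at +oo: r1 is either always nonpositive or eventually positive, so r
    is eventually monotone.  If r stayed in a compact subset of ]0, +oo[, then
    lam would be bounded, say by L, and the function
    - 2 lam + 2 L^2 (r1 +/- L r / 2) would be bounded; but its derivative
    dominates |A W|^2, which is bounded below by a positive constant
    ([r_not_confined]).  So r tends to 0 or to +oo ([r_cvg_0_infty]).

    The scalar equations are invariant under reversal of the parameter
    ([scalar_system_opp]), which gives the limits at -oo. *)

(** * Differential inequalities on the real line *)

Lemma is_derive_continuous (R : realType) (f : R -> R) (s df : R) :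
  is_derive s 1 f df -> {for s, continuous f}.
Proof.
by move=> [fs _]; apply: differentiable_continuous; exact/derivable1_diffP.
Qed.

Lemma mean_value (R : realType) (f df : R -> R) (a b : R) :
  (forall s : R, is_derive s 1 f (df s)) -> a <= b ->
  exists2 c, a <= c <= b & f b - f a = df c * (b - a).
Proof.
move=> fdf ab; have [|c cab ->] := MVT_segment ab (fun x _ => fdf x).
  by apply: continuous_subspaceT => x; exact: is_derive_continuous (fdf x).
by exists c => //; move: cab; rewrite in_itv.
Qed.

Lemma derive_ge_increment (R : realType) (f df : R -> R) (a b c : R) :
  (forall s : R, is_derive s 1 f (df s)) -> a <= b ->
  (forall s, a <= s <= b -> c <= df s) -> c * (b - a) <= f b - f a.
Proof.
move=> fdf ab cdf; have [x xab ->] := mean_value fdf ab.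
by rewrite ler_wpM2r ?subr_ge0// cdf.
Qed.

Lemma derive_ge_unbounded (R : realType) (f df : R -> R) (a c M : R) :
  (forall s : R, is_derive s 1 f (df s)) -> 0 < c ->
  (forall s, a <= s -> c <= df s) -> exists2 s, a <= s & M < f s.
Proof.
move=> fdf c0 cdf; pose t := (`|M - f a| + 1) / c.
have t0 : 0 <= t by rewrite divr_ge0// ltW.
exists (a + t); first by rewrite lerDl.
have : c * (a + t - a) <= f (a + t) - f a.
  apply: derive_ge_increment => //; first by rewrite lerDl.
  by move=> s /andP[? _]; exact: cdf.
have -> : c * (a + t - a) = `|M - f a| + 1 by rewrite /t; field; rewrite gt_eqF.
have := ler_norm (M - f a); lra.
Qed.

(** Positivity propagates forward under f' >= lam f with lam nonincreasing: at a
    first zero c of f before b, f x * exp (- lam b * x) would have decreased,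
    although lam >= lam b and f > 0 on [a, c[ make its derivative nonnegative. *)
Lemma differential_ineq_gt0 (R : realType) (f df lam : R -> R) (a : R) :
  (forall s : R, is_derive s 1 f (df s)) ->
  (forall s t, a <= s -> s <= t -> lam t <= lam s) ->
  (forall s, a <= s -> lam s * f s <= df s) ->
  0 < f a -> forall s, a <= s -> 0 < f s.
Proof.
move=> fdf lamN ldf fa0 b ab; rewrite ltNge; apply/negP => fb0.
pose S := [set x | a <= x <= b /\ f x <= 0].
have Sb : S b by rewrite /S /= ab lexx.
have lS : lbound S a by move=> x [/andP[]].
have hS : has_inf S by split; [exists b | exists a].
(* c is the first point of [a, b] where f is not positive. *)
pose c := inf S.
have ac : a <= c by apply: lb_le_inf => //; exact: hS.1.
have cb : c <= b by apply: ge_inf => //; exact: hS.2.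
have fpos x : a <= x -> x < c -> 0 < f x.
  move=> ax xc; rewrite ltNge; apply/negP => fx0.
  have : c <= x.
    by apply: ge_inf; [exact: hS.2|split=> //; rewrite ax/= (ltW (lt_le_trans xc cb))].
  by rewrite leNgt xc.
have fc0 : f c <= 0.
  rewrite leNgt; apply/negP => fc0.
  have H : \forall x \near c, 0 < f x.
    exact: cvgr_gt (f c) (is_derive_continuous (fdf c)) _ fc0.
  have [e /= e0 fe] := (nbhs_normP c _).1 H.
  have [x [/andP[ax xb] fx0] xc] := inf_adherent e0 hS.
  have cx : c <= x by apply: ge_inf; [exact: hS.2 | rewrite /S /= ax xb].
  have : 0 < f x.
    by apply: fe; rewrite /= distrC ger0_norm ?subr_ge0// ltrBlDl.
  by rewrite ltNge fx0.
pose l := lam b.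
pose g := fun x => f x * expR (- l * x).
pose dg := fun x => (df x - l * f x) * expR (- l * x).
have gdg (s : R) : is_derive s 1 g (dg s).
  have h := fdf s.
  by apply: is_derive_eq; rewrite /dg /GRing.scale /=; ring.
have altc : a < c.
  by rewrite lt_neqAle ac andbT; apply/eqP => aec; move: fc0; rewrite -aec leNgt fa0.
have [|x] := MVT altc (fun x _ => gdg x).
  by apply: continuous_subspaceT => x; exact: is_derive_continuous (gdg x).
rewrite in_itv/= => /andP[ax xc] gE.
have : 0 <= g c - g a.
  rewrite gE mulr_ge0//; last by rewrite subr_ge0 ltW.
  rewrite mulr_ge0 ?expR_ge0// subr_ge0; apply: le_trans (ldf _ (ltW ax)).
  rewrite ler_wpM2r//; first by rewrite ltW// fpos// ltW.
  by rewrite lamN// ?ltW// (lt_le_trans xc).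
rewrite leNgt subr_lt0 (@le_lt_trans _ _ 0)//.
- by rewrite mulr_le0_ge0// expR_ge0.
- by rewrite mulr_gt0// expR_gt0.
Qed.

(** * The scalar equations of a soliton *)

(** The scalar functions attached to a soliton, with the only relations between
    them that the argument needs: [z] and its derivative [z1], [lam], the squared
    curvature [k2], [r] = |W|^2 and half its derivative [r1], [w2] = |P T|^2 and
    [q] = |A C|^2.  The constant [m] is |v|^2; [a], [b] bound the growth of [lam],
    and [K] dominates the squared operator norms of A and of its inverse on its
    range. *)
Record scalar_system (R : realType) (m a b K : R)
    (z z1 lam k2 r r1 w2 q : R -> R) : Prop := ScalarSystem {
  sys_m_gt0 : 0 < m;
  sys_a_ge0 : 0 <= a;
  sys_b_gt0 : 0 < b;
  sys_K_gt0 : 0 < K;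
  sys_k2_ge0 : forall s, 0 <= k2 s;
  sys_r_ge0 : forall s, 0 <= r s;
  sys_w2_ge0 : forall s, 0 <= w2 s;
  sys_z : forall s : R, is_derive s 1 z (z1 s);
  sys_z1 : forall s : R, is_derive s 1 z1 (lam s * z1 s + m);
  sys_lam : forall s : R, is_derive s 1 lam (- k2 s);
  sys_r : forall s : R, is_derive s 1 r (2 * r1 s);
  sys_r1 : forall s : R, is_derive s 1 r1 (lam s * r1 s + w2 s);
  sys_z1_le : forall s, z1 s ^+ 2 <= m;
  sys_r1_le : forall s, r1 s ^+ 2 <= r s;
  sys_lam_r : forall s, lam s ^+ 2 <= K * r s + m;
  sys_r_q : forall s, r s <= K * q s;
  sys_q_le : forall s, q s <= 2 * (k2 s + lam s ^+ 2 * w2 s);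
  sys_lam_le : forall s, `|lam s| <= a + b * `|s| }.

Section ScalarSystem.
Variables (R : realType) (m a b K : R) (z z1 lam k2 r r1 w2 q : R -> R).
Hypothesis sys : scalar_system m a b K z z1 lam k2 r r1 w2 q.

Let m_gt0 : 0 < m := sys_m_gt0 sys.
Let a_ge0 := sys_a_ge0 sys.
Let b_gt0 := sys_b_gt0 sys.
Let K_gt0 := sys_K_gt0 sys.

Lemma lam_nincr s t : s <= t -> lam t <= lam s.
Proof.
move=> st; rewrite -subr_le0 -oppr_ge0.
have [c _ ->] := mean_value (sys_lam sys) st.
by rewrite -mulNr opprK mulr_ge0// ?subr_ge0// (sys_k2_ge0 sys).
Qed.

Lemma z1_le s : z1 s <= m + 1.
Proof. have := sys_z1_le sys s; have := sqr_ge0 (z1 s - 1); nra. Qed.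

Lemma z1_gt0 s t : 0 < z1 s -> s <= t -> 0 < z1 t.
Proof.
move=> z1s; move: t.
apply: (differential_ineq_gt0 (lam := lam) (sys_z1 sys)) => // [u v _|u _].
  exact: lam_nincr.
by rewrite lerDl ltW.
Qed.

(** After a critical point, z is strictly increasing for ever. *)
Lemma z1_crit_gt0 s t : z1 s = 0 -> s < t -> 0 < z1 t.
Proof.
move=> z1s st; pose d x := lam x * z1 x + m.
have dc : {for s, continuous d}.
  apply: (is_derive_continuous (df := - k2 s * z1 s + lam s * d s)).
  have h1 := sys_lam sys s; have h2 := sys_z1 sys s.
  by apply: is_derive_eq; rewrite /GRing.scale /= /d; ring.
have H : \forall x \near s, 0 < d x.
  by apply: cvgr_gt (d s) dc _ _; rewrite /d z1s mulr0 add0r.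
have [e /= e0 de] := (nbhs_normP s _).1 H.
pose u := Num.min t (s + e / 2).
have su : s < u by rewrite lt_min st ltrDl divr_gt0.
have z1u : 0 < z1 u.
  suff : 0 < z1 u - z1 s by rewrite z1s subr0.
  have [|x] := MVT su (fun x _ => sys_z1 sys x).
    apply: continuous_subspaceT => x; exact: is_derive_continuous (sys_z1 sys x).
  rewrite in_itv/= => /andP[sx xu] ->.
  rewrite mulr_gt0 ?subr_gt0//; apply: de => /=.
  rewrite distrC gtr0_norm ?subr_gt0//.
  have : u <= s + e / 2 by rewrite ge_min lexx orbT.
  lra.
by apply: z1_gt0 z1u _; rewrite ge_min lexx.
Qed.

Lemma z_unique_min x y : is_local_min z x -> is_local_min z y -> x = y.
Proof.
have crit u : is_local_min z u -> z1 u = 0.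
  move=> /(nbhs_normP u _).1 [e /= e0 ue].
  have ule : u - e <= u + e by lra.
  have := @derive1_at_min _ z (u - e) (u + e) u ule.
  case=> [t _||t|_ <-].
  - by have [] := sys_z sys t.
  - rewrite in_itv/=; lra.
  - rewrite in_itv/= => /andP[t1 t2]; apply: ue => /=.
    by rewrite distrC ltr_norml; lra.
  - by rewrite (@derive_val _ _ _ _ _ _ _ (sys_z sys u)).
move=> /crit zx /crit zy; case: (ltgtP x y) => // /z1_crit_gt0.
- by move=> /(_ zx); rewrite zy ltxx.
- by move=> /(_ zy); rewrite zx ltxx.
Qed.

Lemma z_cvg_ninfty : (forall s, 0 <= s -> 0 < lam s) ->
  z s @[s --> +oo%R] --> -oo%R.
Proof.
move=> lam0; pose c := m / (2 * lam 0).
have l0 := lam0 _ (lexx 0).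
have c0 : 0 < c by rewrite divr_gt0// mulr_gt0.
have z1c s : 0 <= s -> z1 s <= - c.
  move=> s0; rewrite leNgt; apply/negP => z1s.
  (* Once u = z1 + c is positive it remains so, and then z1' >= m / 2. *)
  pose u x := z1 x + c.
  have udu (x : R) : is_derive x 1 u (lam x * z1 x + m).
    have h := sys_z1 sys x; by apply: is_derive_eq; rewrite addr0.
  have du x : s <= x -> lam x * u x + m / 2 <= lam x * z1 x + m.
    move=> sx; rewrite /u mulrDr.
    suff : lam x * c <= m / 2 by lra.
    have -> : m / 2 = lam 0 * c by rewrite /c; field; rewrite gt_eqF.
    by rewrite ler_wpM2r ?(ltW c0)// lam_nincr// (le_trans s0).
  have u0 x : s <= x -> 0 < u x.
    apply: (differential_ineq_gt0 (lam := lam) udu).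
    + by move=> ? ? _; exact: lam_nincr.
    + by move=> y sy; apply: le_trans (du y sy); rewrite lerDl divr_ge0// ltW.
    + by rewrite /u; lra.
  have [t _] : exists2 t, s <= t & m + 1 < z1 t.
    apply: (derive_ge_unbounded (c := m / 2) _ (sys_z1 sys)); first by rewrite divr_gt0.
    move=> x sx; apply: le_trans (du x sx); rewrite lerDr.
    by rewrite mulr_ge0// ltW// ?u0// lam0// (le_trans s0).
  by rewrite ltNge z1_le.
apply/cvgrNyPle => M.
pose S := Num.max 0 ((z 0 - M) / c).
exists S; split; first exact: num_real.
move=> s Ss; have s0 : 0 <= s by rewrite (le_trans _ (ltW Ss))// le_max lexx.
have := derive_ge_increment (f := \- z) (df := fun x => - z1 x) (c := c) _ s0.
have -> : c * (s - 0) = c * s by rewrite subr0.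
move=> H; have {H} : c * s <= - z s - - z 0.
  apply: H => [x|x /andP[x0 _]]; last by rewrite lerNr z1c.
  have h := sys_z sys x; exact: is_derive_eq.
have : (z 0 - M) / c < s by rewrite (le_lt_trans _ Ss)// le_max lexx orbT.
rewrite ltr_pdivrMr//; lra.
Qed.

Lemma z_cvg_pinfty s1 : lam s1 <= 0 -> z s @[s --> +oo%R] --> +oo%R.
Proof.
move=> lam_s1.
have lam_le0 s : s1 <= s -> lam s <= 0 by move=> /lam_nincr/le_trans; exact.
(* If z1 <= 0 for ever, then z1' >= m, since lam z1 >= 0. *)
have [s2 s12 z1s2] : exists2 s2, s1 <= s2 & 0 < z1 s2.
  apply: contrapT => H.
  have z1n s : s1 <= s -> z1 s <= 0.
    by move=> s1s; rewrite leNgt; apply/negP => ?; apply: H; exists s.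
  have [t s1t] : exists2 t, s1 <= t & 0 < z1 t.
    apply: (derive_ge_unbounded (c := m) _ (sys_z1 sys)) => // x s1x.
    by rewrite lerDr mulr_le0// ?lam_le0// z1n.
  by rewrite ltNge z1n.
pose s3 := Num.max 0 s2.
have s30 : 0 <= s3 by rewrite le_max lexx.
have s23 : s2 <= s3 by rewrite le_max lexx orbT.
have z1pos s : s3 <= s -> 0 < z1 s.
  by move=> s3s; apply: z1_gt0 z1s2 _; apply: le_trans s3s.
have zincr s t : s3 <= s -> s <= t -> z s <= z t.
  move=> s3s st; rewrite -subr_ge0 -[0](mul0r (t - s)).
  apply: derive_ge_increment (sys_z sys) st _ => x /andP[sx _].
  by rewrite ltW// z1pos// (le_trans s3s).
suff unb M : exists2 s, s3 <= s & M < z s.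
  apply/cvgryPge => M; have [S s3S zS] := unb M.
  exists S; split; first exact: num_real.
  by move=> s Ss; rewrite (le_trans (ltW zS))// zincr// ltW.
apply: contrapT => bnd.
pose E := [set z s | s in [set s | s3 <= s]].
have hE : has_sup E.
  split; first by exists (z s3), s3 => /=.
  exists M => _ [s s3s <-]; rewrite leNgt; apply/negP => ?.
  by apply: bnd; exists s.
pose Z := sup E.
have zZ s : s3 <= s -> z s <= Z by move=> ?; apply: ub_le_sup; [exact: hE.2|exists s].
have [_ [s4 /= s34 <-] zs4] : exists2 e, E e & Z - m / (2 * b) < e.
  by apply: sup_adherent => //; rewrite divr_gt0// mulr_gt0.
(* On [s4, +oo[, z is within m / (2 b) of Z, so that H' >= m / 2, while
   H <= m + 1 + a Z. *)
pose H s := z1 s + (a + b * s) * z s - b * Z * s.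
pose dH s := lam s * z1 s + m + (a + b * s) * z1 s + b * z s - b * Z.
have HdH (s : R) : is_derive s 1 H (dH s).
  have h1 := sys_z sys s; have h2 := sys_z1 sys s.
  by apply: is_derive_eq; rewrite /GRing.scale /= /dH; ring.
have [t s4t] : exists2 t, s4 <= t & m + 1 + a * Z < H t.
  apply: (derive_ge_unbounded (c := m / 2) _ HdH); first by rewrite divr_gt0.
  move=> x s4x; have s3x : s3 <= x by exact: le_trans s4x.
  have x0 : 0 <= x by exact: le_trans s3x.
  have h1 : 0 <= (lam x + (a + b * x)) * z1 x.
    rewrite mulr_ge0// ?(ltW (z1pos _ _))//.
    have := sys_lam_le sys x; rewrite (ger0_norm x0) ler_norml; lra.
  have h2 : b * (Z - m / (2 * b)) <= b * z x.
    by rewrite ler_pM2l// (le_trans (ltW zs4))// zincr.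
  have h3 : b * (Z - m / (2 * b)) = b * Z - m / 2 by field; rewrite gt_eqF.
  rewrite /dH; lra.
have s3t : s3 <= t by exact: le_trans s4t.
have t0 : 0 <= t by exact: le_trans s3t.
rewrite /H ltNge => /negP; apply.
have h1 := z1_le t.
have h2 : (a + b * t) * z t <= (a + b * t) * Z.
  by rewrite ler_wpM2l ?zZ// addr_ge0// mulr_ge0// ltW.
lra.
Qed.

Lemma z_cvg_infty :
  (z s @[s --> +oo%R] --> +oo%R) \/ (z s @[s --> +oo%R] --> -oo%R).
Proof.
have [[s ls]|H] := pselect (exists s, lam s <= 0).
  by left; exact: z_cvg_pinfty ls.
right; apply: z_cvg_ninfty => s _; rewrite ltNge; apply/negP => ?.
by apply: H; exists s.
Qed.

Lemma r1_gt0 s t : 0 < r1 s -> s <= t -> 0 < r1 t.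
Proof.
move=> r1s; move: t.
apply: (differential_ineq_gt0 (lam := lam) (sys_r1 sys)) => // [u v _|u _].
  exact: lam_nincr.
by rewrite lerDl (sys_w2_ge0 sys).
Qed.

(** While [r1] keeps the sign [eps], [r] cannot stay in a compact subset of
    ]0, +oo[. *)
Lemma r_not_confined (s0 rho B eps : R) : 0 < rho -> eps = 1 \/ eps = -1 ->
  (forall s, s0 <= s -> 0 <= eps * r1 s) ->
  ~ forall s, s0 <= s -> rho <= r s <= B.
Proof.
move=> rho0 eps1 epsr1 rB.
have B0 : 0 < B by have /andP[h1 h2] := rB s0 (lexx s0); lra.
pose L := K * B + m + 1.
have KB0 : 0 < K * B by rewrite mulr_gt0.
have L1 : 1 <= L by have := sys_m_gt0 sys; rewrite /L; lra.
have lamL s : s0 <= s -> `|lam s| <= L.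
  move=> /rB/andP[_ rs]; have h := sys_lam_r sys s.
  have h' : lam s ^+ 2 <= L ^+ 2.
    apply: (@le_trans _ _ L); last by rewrite ler_eXnr.
    have : K * r s <= K * B by rewrite ler_pM2l.
    by rewrite /L; lra.
  by rewrite -(ler_pXn2r (n := 2))// ?nnegrE ?real_normK ?num_real//; lra.
(* F' >= q because w2 = r1' - lam r1 <= r1' + L eps r1, where eps r1 = |r1|. *)
pose F s := - 2 * lam s + 2 * L ^+ 2 * (r1 s + eps * L / 2 * r s).
pose dF s := 2 * k2 s + 2 * L ^+ 2 * (lam s * r1 s + w2 s + eps * L * r1 s).
have FdF (s : R) : is_derive s 1 F (dF s).
  have h1 := sys_lam sys s; have h2 := sys_r sys s; have h3 := sys_r1 sys s.
  by apply: is_derive_eq; rewrite /GRing.scale /= /dF; field.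
have r1B s : s0 <= s -> `|r1 s| <= B + 1.
  move=> /rB/andP[_ rs]; have := sys_r1_le sys s.
  have := sqr_ge0 (r1 s - 1); have := sqr_ge0 (r1 s + 1).
  rewrite ler_norml; nra.
have [s s0s] : exists2 s, s0 <= s &
    2 * L + 2 * L ^+ 2 * (B + 1 + L / 2 * B) < F s.
  apply: (derive_ge_unbounded (c := rho / K) _ FdF); first by rewrite divr_gt0.
  move=> s s0s; have /andP[rs _] := rB _ s0s.
  apply: (@le_trans _ _ (q s)).
    by rewrite ler_pdivrMr// mulrC (le_trans rs)// (sys_r_q sys).
  apply: le_trans (sys_q_le sys s) _.
  have hl := lamL _ s0s.
  have lam2 : lam s ^+ 2 <= L ^+ 2.
    by rewrite -real_normK ?num_real// ler_pXn2r// ?nnegrE//; lra.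
  have h1 : lam s ^+ 2 * w2 s <= L ^+ 2 * w2 s.
    by rewrite ler_wpM2r// (sys_w2_ge0 sys).
  have h2 : 0 <= L ^+ 2 * (lam s * r1 s + eps * L * r1 s).
    rewrite mulr_ge0 ?sqr_ge0//; move: hl (epsr1 _ s0s); rewrite ler_norml.
    by case: eps1 => ->; nra.
  rewrite /dF; lra.
rewrite ltNge => /negP; apply.
have h1 := lamL _ s0s; have h2 := r1B _ s0s; have /andP[_ h3] := rB _ s0s.
have h4 := sys_r_ge0 sys s.
apply: lerD; first by move: h1; rewrite ler_norml; lra.
apply: ler_wpM2l; first by rewrite mulr_ge0 ?sqr_ge0.
apply: lerD; first exact: le_trans (ler_norm _) h2.
apply: (@le_trans _ _ (L / 2 * r s)); last by rewrite ler_wpM2l//; lra.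
by rewrite ler_wpM2r// ler_wpM2r//; case: eps1 => ->; lra.
Qed.

Lemma r_cvg_0_infty :
  (Num.sqrt (r s) @[s --> +oo%R] --> (0 : R)) \/
  (Num.sqrt (r s) @[s --> +oo%R] --> +oo%R).
Proof.
have [[s0 r1s0]|H] := pselect (exists s, 0 < r1 s).
  right.
  have rincr s t : s0 <= s -> s <= t -> r s <= r t.
    move=> s0s st; rewrite -subr_ge0 -[0](mul0r (t - s)).
    apply: derive_ge_increment (sys_r sys) st _ => x /andP[sx _].
    by rewrite mulr_ge0// ltW// (r1_gt0 r1s0)// (le_trans s0s).
  have rs0 : 0 < r s0 by apply: lt_le_trans (sys_r1_le sys s0); rewrite exprn_gt0.
  apply/cvgryPge => M.
  have [S s0S rS] : exists2 S, s0 <= S & M ^+ 2 < r S.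
    apply: contrapT => bnd.
    apply: (@r_not_confined s0 (r s0) (M ^+ 2) 1 rs0 (or_introl erefl)).
      by move=> s s0s; rewrite mul1r ltW// (r1_gt0 r1s0).
    move=> s s0s; rewrite rincr//= leNgt; apply/negP => ?.
    by apply: bnd; exists s.
  exists S; split; first exact: num_real.
  move=> s Ss; apply: (le_trans (ler_norm M)); rewrite -sqrtr_sqr.
  by rewrite ler_wsqrtr// (le_trans (ltW rS))// rincr// ltW.
left.
have r1n s : r1 s <= 0 by rewrite leNgt; apply/negP => ?; apply: H; exists s.
have rdecr s t : s <= t -> r t <= r s.
  move=> st; rewrite -subr_le0; have [x _ ->] := mean_value (sys_r sys) st.
  by rewrite mulr_le0_ge0 ?subr_ge0// pmulr_rle0.
apply/cvgrPdist_lt => e e0.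
have [S _ rS] : exists2 S, 0 <= S & r S < e ^+ 2.
  apply: contrapT => bnd.
  apply: (@r_not_confined 0 (e ^+ 2) (r 0) (-1)); first by rewrite exprn_gt0.
  - by right.
  - by move=> s _; rewrite mulN1r oppr_ge0.
  - move=> s s0; rewrite rdecr// andbT leNgt; apply/negP => ?.
    by apply: bnd; exists s.
exists S; split; first exact: num_real.
move=> s Ss; rewrite sub0r normrN ger0_norm ?sqrtr_ge0//.
rewrite -(gtr0_norm e0) -sqrtr_sqr ltr_sqrt ?exprn_gt0//.
by rewrite (le_lt_trans _ rS)// rdecr// ltW.
Qed.

End ScalarSystem.

(** * Reversal of the parameter *)

Lemma is_derive_comp_opp (R : realType) (f df : R -> R) :
  (forall s : R, is_derive s 1 f (df s)) ->
  forall s : R, is_derive s 1 (fun x => f (- x)) (- df (- s)).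
Proof.
move=> fdf s; have h := fdf (- s).
have h1 : is_derive s 1 (-%R : R -> R) (-1) by apply: is_derive_eq.
have h2 := is_derive1_comp (x := s) h h1.
by apply: is_derive_eq h2 _; rewrite mulrN1.
Qed.

Lemma scalar_system_opp (R : realType) (m a b K : R)
    (z z1 lam k2 r r1 w2 q : R -> R) :
  scalar_system m a b K z z1 lam k2 r r1 w2 q ->
  scalar_system m a b K (fun s => z (- s)) (fun s => - z1 (- s))
    (fun s => - lam (- s)) (fun s => k2 (- s)) (fun s => r (- s))
    (fun s => - r1 (- s)) (fun s => w2 (- s)) (fun s => q (- s)).
Proof.
have opp (f df : R -> R) : (forall s : R, is_derive s 1 f (df s)) ->
    forall s : R, is_derive s 1 (fun x => - f (- x)) (df (- s)).
  move=> /is_derive_comp_opp h s; have hs := h s.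
  by rewrite -[df _]opprK; exact: is_deriveN.
case=> m0 a0 b0 K0 k20 r0 w20 dz dz1 dlam dr dr1 z1m r1r lamr rq qle lamle.
split=> // s.
- exact: is_derive_comp_opp dz s.
- by rewrite mulrNN; exact: opp dz1 s.
- exact: opp dlam s.
- by rewrite mulrN; exact: is_derive_comp_opp dr s.
- by rewrite mulrNN; exact: opp dr1 s.
- by rewrite sqrrN.
- by rewrite sqrrN.
- by rewrite sqrrN.
- by rewrite sqrrN.
- by rewrite normrN -[`|s|]normrN.
Qed.

(** * The Euclidean inner product *)

Section Inner.
Variables (R : realType) (n : nat).
Implicit Types (x y w : 'cV[R]_n) (c : R) (M : 'M[R]_n).

Lemma innerE x y : inner x y = (x^T *m y) ord0 ord0.
Proof. by rewrite mxE; apply: eq_bigr => i _; rewrite mxE. Qed.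

Lemma innerC x y : inner x y = inner y x.
Proof. by apply: eq_bigr => i _; rewrite mulrC. Qed.

Lemma innerDr x y w : inner x (y + w) = inner x y + inner x w.
Proof. by rewrite !innerE mulmxDr mxE. Qed.

Lemma innerZr c x y : inner x (c *: y) = c * inner x y.
Proof. by rewrite !innerE -scalemxAr mxE. Qed.

Lemma innerDl x y w : inner (x + y) w = inner x w + inner y w.
Proof. by rewrite innerC innerDr !(innerC w). Qed.

Lemma innerZl c x y : inner (c *: x) y = c * inner x y.
Proof. by rewrite innerC innerZr innerC. Qed.

Lemma innerNr x y : inner x (- y) = - inner x y.
Proof. by rewrite -scaleN1r innerZr mulN1r. Qed.

Lemma innerNl x y : inner (- x) y = - inner x y.
Proof. by rewrite innerC innerNr innerC. Qed.

Lemma inner0r x : inner x 0 = 0.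
Proof. by rewrite innerE mulmx0 mxE. Qed.

Lemma inner_trmx M x y : inner (M *m x) y = inner x (M^T *m y).
Proof. by rewrite !innerE trmx_mul mulmxA. Qed.

Lemma inner_ge0 x : 0 <= inner x x.
Proof. by apply: sumr_ge0 => i _; rewrite -expr2 sqr_ge0. Qed.

Lemma inner_eq0 x : inner x x = 0 -> x = 0.
Proof.
move=> /eqP; rewrite psumr_eq0 => [/allP H|i _]; last by rewrite -expr2 sqr_ge0.
apply/matrixP => i j; rewrite (ord1 j) mxE.
by have := H i (mem_index_enum i); rewrite mulf_eq0 orbb => /eqP.
Qed.

Lemma inner_gt0 x : x != 0 -> 0 < inner x x.
Proof.
move=> x0; rewrite lt_neqAle inner_ge0 andbT eq_sym.
by apply: contra x0 => /eqP/inner_eq0 ->.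
Qed.

Lemma Cauchy_Schwarz_inner x y : inner x y ^+ 2 <= inner x x * inner y y.
Proof.
have [->|y0] := eqVneq y 0; first by rewrite !inner0r mulr0 expr0n.
have yy := inner_gt0 y0.
have := inner_ge0 (inner y y *: x + (- inner x y) *: y).
rewrite !innerDl !innerDr !innerZl !innerZr (innerC y x).
rewrite [X in 0 <= X](_ : _ =
  inner y y * (inner x x * inner y y - inner x y ^+ 2)); last by ring.
by rewrite pmulr_rge0// subr_ge0.
Qed.

Lemma inner_sub_le x y :
  inner (x - y) (x - y) <= 2 * (inner x x + inner y y).
Proof.
have := inner_ge0 (x + y).
rewrite !innerDl !innerDr !innerNl !innerNr (innerC y x); lra.
Qed.

Lemma mulmx_inner_bounded M :
  exists2 K, 0 < K & forall x, inner (M *m x) (M *m x) <= K * inner x x.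
Proof.
pose rowv i : 'cV[R]_n := (row i M)^T.
exists (\sum_i inner (rowv i) (rowv i) + 1).
  by rewrite ltr_pwDr// sumr_ge0// => i _; exact: inner_ge0.
move=> x; rewrite mulrDl mul1r.
suff : inner (M *m x) (M *m x) <= (\sum_i inner (rowv i) (rowv i)) * inner x x.
  by have := inner_ge0 x; lra.
rewrite mulr_suml; apply: ler_sum => i _; rewrite -expr2.
have -> : (M *m x) i ord0 = inner (rowv i) x.
  by rewrite mxE; apply: eq_bigr => j _; rewrite !mxE.
exact: Cauchy_Schwarz_inner.
Qed.

End Inner.

(** * Derivatives of curves *)

Section CurveDerivative.
Variables (R : realType) (n : nat).
Implicit Types f g : R -> 'cV[R]_n.

(** [df] is the derivative of the curve [f], coordinate by coordinate. *)
Definition curve_derivative (f df : R -> 'cV[R]_n) := forall (i : 'I_n) (s : R),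
  is_derive s 1 (fun x => f x i ord0) (df s i ord0).

Lemma curve_derivative_derive1 f :
  (forall s, derivable f s 1) -> curve_derivative f (derive1 f).
Proof.
move=> fs i s; have /derivable_mxP fij := fs s.
apply: DeriveDef; first exact: fij.
by rewrite derive1E derive_mx// mxE.
Qed.

Lemma is_derive_inner f df g dg : curve_derivative f df -> curve_derivative g dg ->
  forall s : R, is_derive s 1 (fun x => inner (f x) (g x))
    (inner (df s) (g s) + inner (f s) (dg s)).
Proof.
move=> fdf gdg s; rewrite /inner -big_split/=.
have -> : (fun x => \sum_(i < n) f x i ord0 * g x i ord0) =
    \sum_(i < n) ((fun x => f x i ord0) * (fun x => g x i ord0)).
  by apply/funext => x; rewrite fct_sumE.
apply: is_derive_sum => i.
have h1 := fdf i s; have h2 := gdg i s.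
apply: is_derive_eq; rewrite /GRing.scale /=; ring.
Qed.

Lemma curve_derivative_cst x : curve_derivative (fun=> x) (fun=> 0).
Proof. by move=> i s; rewrite mxE; exact: is_derive_cst. Qed.

Lemma curve_derivativeD f df g dg : curve_derivative f df ->
  curve_derivative g dg ->
  curve_derivative (fun s => f s + g s) (fun s => df s + dg s).
Proof.
move=> fdf gdg i s; have h1 := fdf i s; have h2 := gdg i s.
rewrite mxE (_ : (fun x => (f x + g x) i ord0) =
  (fun x => f x i ord0) + (fun x => g x i ord0)); first exact: is_deriveD.
by apply/funext => x; rewrite mxE.
Qed.

Lemma curve_derivativeM (M : 'M[R]_n) f df : curve_derivative f df ->
  curve_derivative (fun s => M *m f s) (fun s => M *m df s).
Proof.
move=> fdf i s; pose row_i : 'cV[R]_n := (row i M)^T.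
have E x : (M *m x) i ord0 = inner row_i x.
  by rewrite mxE; apply: eq_bigr => j _; rewrite !mxE.
rewrite E (_ : (fun x => _) = fun x => inner row_i (f x)); last first.
  by apply/funext => x; rewrite E.
have := is_derive_inner (curve_derivative_cst row_i) fdf s.
by rewrite innerC inner0r add0r.
Qed.

End CurveDerivative.

(** * The orthogonal projection onto the range of an antisymmetric matrix *)

(** An antisymmetric matrix and its square have the same rank, because u A = 0
    with u = w A gives u u^T = - w A A w^T = 0; so they have the same row space,
    whence the factor D. *)
Lemma antisymmetric_mx_sqr (R : realType) (n : nat) (A : 'M[R]_n) :
  antisymmetric_mx A -> exists D : 'M[R]_n, A = D *m (A *m A).
Proof.
move=> hA; apply/submxP.
have ker0 : (A :&: kermx A)%MS = 0.
  apply/eqP; rewrite -submx0; apply/row_subP => i.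
  set u := row i _.
  have /submxP[w uw] : (u <= A)%MS.
    exact: submx_trans (row_sub _ _) (capmxSl _ _).
  have /sub_kermxP uA : (u <= kermx A)%MS.
    exact: submx_trans (row_sub _ _) (capmxSr _ _).
  have uu : inner u^T u^T = 0.
    rewrite innerE trmxK {2}uw trmx_mul hA mulmxA mulmxN uA oppr0 mul0mx.
    by rewrite mxE.
  by rewrite -[u]trmxK (inner_eq0 uu) trmx0 sub0mx.
have rk : \rank (A *m A) = \rank A.
  by have := mxrank_mul_ker A A; rewrite ker0 mxrank0 addn0.
have [_] := mxrank_leqif_sup (submxMl A A).
by rewrite rk eqxx => /esym.
Qed.

Section Projection.
Variables (R : realType) (n : nat) (A D : 'M[R]_n).
Hypothesis hA : antisymmetric_mx A.
Hypothesis hD : A = D *m (A *m A).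

Lemma inner_antisym x y : inner (A *m x) y = - inner x (A *m y).
Proof. by rewrite inner_trmx hA mulNmx innerNr. Qed.

Lemma inner_antisym_diag x : inner (A *m x) x = 0.
Proof. by have := inner_antisym x x; rewrite (innerC x); lra. Qed.

(** The matrix of the orthogonal projection onto the range of A.  Transposing
    A = D A A gives A = A A B with B = - D^T, and then A B is idempotent with
    range that of A and with A (A B) = A. *)
Definition range_proj : 'M[R]_n := - (A *m D^T).
Local Notation P := range_proj.

Lemma mulmx_range_proj : A *m P = A.
Proof.
have : A^T = (D *m (A *m A))^T by rewrite -hD.
rewrite !trmx_mul hA mulNmx mulmxN opprK => E.
by rewrite /P mulmxN mulmxA -E opprK.
Qed.

Lemma inner_range_proj x y : inner (A *m x) (P *m y) = inner (A *m x) y.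
Proof. by rewrite !inner_antisym mulmxA mulmx_range_proj. Qed.

Lemma inner_proj_range_proj x y : inner (P *m x) (P *m y) = inner (P *m x) y.
Proof. by rewrite {1 3}/P -mulmxN -!mulmxA inner_range_proj. Qed.

(** This factorization shows that A is bounded below on its range. *)
Lemma range_proj_factor : P = D *m A.
Proof.
rewrite -[in RHS]mulmx_range_proj {2}/P [in LHS]/P {1}hD.
by rewrite !mulmxN !mulmxA.
Qed.

Lemma is_ortho_proj_range x w :
  is_ortho_proj (mx_range A) x w -> w = P *m x.
Proof.
move=> [[y _ yw] xw].
apply/eqP; rewrite -subr_eq0; apply/eqP/inner_eq0.
(* w - P x lies in the range of A, and A kills it. *)
have E : w - P *m x = A *m (y + D^T *m x).
  by rewrite /P mulNmx opprK mulmxDr yw mulmxA.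
rewrite {1}E inner_antisym.
have -> : A *m (w - P *m x) = A *m (w - x).
  by rewrite !mulmxBr mulmxA mulmx_range_proj.
rewrite -inner_antisym -opprB innerNr innerC xw ?oppr0//.
by exists (y + D^T *m x).
Qed.

End Projection.

(** * From solitons to the scalar equations *)

Lemma ler_norm_sqr (R : realType) (x c : R) : x ^+ 2 <= c -> `|x| <= c + 1.
Proof.
have := sqr_ge0 (x - 1); have := sqr_ge0 (x + 1).
by rewrite ler_norml; nra.
Qed.

(** The witnesses are those named in the documentation of [scalar_system], with
    T = C_s and X = A C + v.  The linear bound on |lam s| comes from the mean
    value theorem for x |-> <A C(x), T(s)>, whose derivative <A T(x), T(s)> is
    bounded. *)
Lemma soliton_scalar_system (R : realType) (n : nat) (A : 'M[R]_n)
    (v : 'cV[R]_n) (C : R -> 'cV[R]_n) :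
  antisymmetric_mx A -> v != 0 -> A *m v = 0 ->
  translating_rotating_soliton A v C ->
  exists (P : 'M[R]_n),
  (forall x w, is_ortho_proj (mx_range A) x w -> w = P *m x) /\
  exists m a b K z1 lam k2 r1 w2 q,
    scalar_system m a b K (fun s => inner v (C s)) z1 lam k2
      (fun s => inner (P *m C s) (P *m C s)) r1 w2 q.
Proof.
move=> hA v0 Av [Csm Car Ceq].
have [D hD] := antisymmetric_mx_sqr hA.
pose P := range_proj A D; exists P; split; first exact: is_ortho_proj_range.
have AP x : A *m (P *m x) = A *m x by rewrite mulmxA mulmx_range_proj.
have PA x : P *m x = D *m (A *m x) by rewrite /P range_proj_factor// mulmxA.
have [K1 K10 AK] := mulmx_inner_bounded A.
have [K2 K20 DK] := mulmx_inner_bounded D.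
pose T := derive1 C; pose X s := A *m C s + v; pose lam := soliton_lambda A v C.
pose ddC s := X s + lam s *: T s.
have dC : curve_derivative C T.
  by apply: curve_derivative_derive1 => s; exact: Csm 0 s.
have dT : curve_derivative T ddC.
  have := curve_derivative_derive1 (Csm 1).
  by rewrite (_ : derive1 (derive1n 1 C) = ddC)//; apply/funext => s; exact: Ceq.
have dX : curve_derivative X (fun s => A *m T s + 0).
  exact: curve_derivativeD (curve_derivativeM A dC) (curve_derivative_cst v).
have dPC := curve_derivativeM P dC.
have TT s : inner (T s) (T s) = 1.
  by rewrite -[LHS]sqr_sqrtr ?inner_ge0// -/(enorm _) Car expr1n.
have CS1 x s : inner x (T s) ^+ 2 <= inner x x.
  by have := Cauchy_Schwarz_inner x (T s); rewrite TT mulr1.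
have lamE s : lam s = - inner (X s) (T s) by [].
have vA x : inner v (A *m x) = 0 by rewrite innerC inner_antisym// Av inner0r oppr0.
have Av0 x : inner (A *m x) v = 0 by rewrite innerC.
have XX s : inner (X s) (X s) = inner (A *m C s) (A *m C s) + inner v v.
  by rewrite /X innerDl !innerDr vA Av0; ring.
have AK' x s : inner (A *m T s) x ^+ 2 <= K1 * inner x x.
  apply: le_trans (Cauchy_Schwarz_inner _ _) _.
  by rewrite ler_wpM2r ?inner_ge0//; apply: le_trans (AK _) _; rewrite TT mulr1.
pose m := inner v v.
exists m, (inner (A *m C 0) (A *m C 0) + 1 + (m + 1)), (K1 + 1), (K1 + K2),
  (fun s => inner v (T s)), lam, (fun s => inner (ddC s) (ddC s)),
  (fun s => inner (P *m C s) (T s)),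
  (fun s => inner (P *m T s) (P *m T s)),
  (fun s => inner (A *m C s) (A *m C s)).
have APC s : inner (A *m (P *m C s)) (A *m (P *m C s)) <=
    K1 * inner (P *m C s) (P *m C s) by exact: AK.
have m0 : 0 <= m by exact: inner_ge0.
split.
- exact: inner_gt0.
- by have := inner_ge0 (A *m C 0); lra.
- by rewrite addr_gt0.
- by rewrite addr_gt0.
- by move=> s; exact: inner_ge0.
- by move=> s; exact: inner_ge0.
- by move=> s; exact: inner_ge0.
- move=> s; have := is_derive_inner (curve_derivative_cst v) dC s.
  by rewrite innerC inner0r add0r.
- move=> s; have := is_derive_inner (curve_derivative_cst v) dT s.
  rewrite innerC inner0r add0r => h; apply: is_derive_eq h _.
  by rewrite /ddC /X !innerDr innerZr vA /m; ring.
- move=> s; have h := is_derive_inner dX dT s.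
  apply: is_derive_eq (is_deriveN h) _.
  rewrite addr0 inner_antisym_diag// add0r.
  rewrite /ddC /X !(innerDl, innerDr, innerZl, innerZr) TT !(innerC (T s)).
  by rewrite lamE /X innerDl; ring.
- move=> s; have h := is_derive_inner dPC dPC s; apply: is_derive_eq h _.
  by rewrite (innerC (P *m T s)) inner_proj_range_proj//; ring.
- move=> s; have h := is_derive_inner dPC dT s; apply: is_derive_eq h _.
  rewrite /ddC /X !innerDr innerZr inner_proj_range_proj//.
  rewrite [inner (P *m C s) (A *m C s)](_ : _ = 0); last first.
    by rewrite -AP innerC inner_antisym_diag.
  rewrite [inner (P *m C s) v](_ : _ = 0); last first.
    by rewrite /P /range_proj mulNmx -mulmxA innerNl Av0 oppr0.
  ring.
- by move=> s; exact: CS1.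
- by move=> s; exact: CS1.
- move=> s; rewrite lamE sqrrN; apply: le_trans (CS1 _ _) _.
  rewrite XX lerD2r -AP; apply: le_trans (APC s) _.
  by rewrite ler_wpM2r ?inner_ge0// lerDl ltW.
- move=> s; rewrite {1}PA {1}PA; apply: le_trans (DK _) _.
  by rewrite ler_wpM2r ?inner_ge0// lerDr ltW.
- move=> s; set q := inner (A *m C s) (A *m C s).
  (* Y is C_ss - lam P T, whose inner product with A C is |A C|^2. *)
  pose Y := ddC s - lam s *: (P *m T s).
  have qY : q = inner (A *m C s) Y.
    rewrite /Y /ddC /X !innerDr innerNr !innerZr inner_range_proj// Av0 -/q.
    by ring.
  have q0 : 0 <= q by exact: inner_ge0.
  have qYY : q <= inner Y Y.
    have := Cauchy_Schwarz_inner (A *m C s) Y; rewrite -qY -/q.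
    have [->|q_neq0] := eqVneq q 0; first by rewrite inner_ge0.
    by rewrite expr2 ler_pM2l// lt_neqAle eq_sym q_neq0.
  apply: le_trans qYY _; apply: le_trans (inner_sub_le _ _) _.
  by rewrite innerZl innerZr mulrA -expr2.
- move=> s.
  have h1 : `|inner v (T s)| <= m + 1 by apply: ler_norm_sqr; exact: CS1.
  have h2 : `|inner (A *m C 0) (T s)| <= inner (A *m C 0) (A *m C 0) + 1.
    by apply: ler_norm_sqr; exact: CS1.
  pose g x := inner (A *m C x) (T s).
  have dg (x : R) : is_derive x 1 g (inner (A *m T x) (T s)).
    have h := is_derive_inner (curve_derivativeM A dC) (curve_derivative_cst (T s)) x.
    by apply: is_derive_eq h _; rewrite inner0r addr0.
  have dgK x : `|inner (A *m T x) (T s)| <= K1 + 1.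
    by apply: ler_norm_sqr; have := AK' (T s) x; rewrite TT mulr1.
  have h3 : `|g s - g 0| <= (K1 + 1) * `|s|.
    case: (leP 0 s) => [s0|/ltW s0].
      have [x _ ->] := mean_value dg s0.
      by rewrite normrM subr0 ler_wpM2r.
    have [x _] := mean_value dg s0.
    by rewrite distrC => ->; rewrite normrM sub0r normrN ler_wpM2r.
  have -> : lam s = - (g s - g 0) - inner (A *m C 0) (T s) - inner v (T s).
    by rewrite lamE /X innerDl /g; ring.
  move: h1 h2 h3; rewrite !ler_norml; lra.
Qed.

Theorem lemma6p4 (R : realType) (n : nat) (A : 'M[R]_n) (v : 'cV[R]_n)
    (C W : R -> 'cV[R]_n) (z : R -> R)
    (hA : antisymmetric_mx A) (hv : v != 0) (hAv : A *m v = 0)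
    (hC : translating_rotating_soliton A v C)
    (hW : forall s : R, is_ortho_proj (mx_range A) (C s) (W s))
    (hz : forall s : R, z s = inner v (C s)) :
  [/\ forall a b : R, is_local_min z a -> is_local_min z b -> a = b,
      (z s @[s --> +oo%R] --> +oo%R) \/ (z s @[s --> +oo%R] --> -oo%R)
    & (z s @[s --> -oo%R] --> +oo%R) \/ (z s @[s --> -oo%R] --> -oo%R)]
  /\
  [/\ (enorm (W s) @[s --> +oo%R] --> (0 : R)) \/
        (enorm (W s) @[s --> +oo%R] --> +oo%R)
    & (enorm (W s) @[s --> -oo%R] --> (0 : R)) \/
        (enorm (W s) @[s --> -oo%R] --> +oo%R)].
Proof.
have [P [PW [m [a [b [K [z1 [lam [k2 [r1 [w2 [q sys]]]]]]]]]]]] :=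
  soliton_scalar_system hA hv hAv hC.
have -> : z = fun s => inner v (C s) by apply/funext.
have -> : W = fun s => P *m C s by apply/funext => s; exact: PW.
have sysN := scalar_system_opp sys.
split; split.
- exact: z_unique_min sys.
- exact: z_cvg_infty sys.
- have H := z_cvg_infty sysN.
  by case: H => h; [left|right]; apply/cvgNy_compNP.
- exact: r_cvg_0_infty sys.
- have H := r_cvg_0_infty sysN.
  by case: H => h; [left|right]; apply/cvgNy_compNP.
Qed.
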